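(* A non-negative matrix $q=(q(n:m),\,1\le m\le n<\infty)$ is the decrement matrix of some regenerative composition structure if and only if $q(1:1)=1$ and $$q(n:m)=\frac{m+1}{n+1}\,q(n+1:m+1)+\frac{n+1-m}{n+1}\,q(n+1:m)+\frac1{n+1}\,q(n+1:1)\,q(n:m)$$ for all $1\le m\le n$.
   Context: A composition of $n$ is a sequence of positive integers (its parts) with sum $n$. A composition structure $(\mathcal C_n)_{n\ge1}$ is a Markovian sequence of random compositions $\mathcal C_n$ of $n$ such that, if $n$ identical balls are distributed into an ordered series of boxes according to $\mathcal C_n$, then $\mathcal C_{n-1}$ is obtained by discarding one of the balls picked uniformly at random and then deleting an empty box in case one is created. It is regenerative if for all $n>m\ge1$, given that the first part of $\mathcal C_n$ is $m$, the remaining composition of $n-m$ is distributed like $\mathcal C_{n-m}$. The decrement matrix of $(\mathcal C_n)$ is $q(n:m)=\mathbb P(\text{the first part of }\mathcal C_n\text{ equals }m)$, $1\le m\le n$. *)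

(* Defs.v *)
From mathcomp Require Import all_boot all_order all_algebra.
From mathcomp Require Import all_classical all_reals all_analysis.
Set Implicit Arguments.
Unset Strict Implicit.
Unset Printing Implicit Defensive.
Import Order.TTheory GRing.Theory Num.Theory.
Local Open Scope classical_set_scope.
Local Open Scope ring_scope.

Definition is_composition (n : nat) (c : seq nat) : bool :=
  all (fun k => 0 < k)%N c && (sumn c == n).

(* The balls in the boxes of [c] are numbered from left to right by
   0, ..., sumn c - 1, so that ball [b] lies in box [reshape_index c b];
   the filter deletes the box of [b] when it becomes empty. *)
Definition discard_ball (c : seq nat) (b : nat) : seq nat :=
  let i := reshape_index c b in
  [seq k <- set_nth 0%N c i (nth 0%N c i).-1 | (0 < k)%N].

Section RandomCompositions.
Context {d : measure_display} {T : measurableType d} {R : realType}.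
Variable P : probability T R.

(* Meaningful only when P B != 0; every use below is guarded accordingly. *)
Definition cond_prob (A B : set T) : R := fine (P (A `&` B)) / fine (P B).

(* The compositions of [n] form a finite set, which carries the discrete
   sigma-algebra. *)
Definition random_composition (n : nat) (X : T -> seq nat) : Prop :=
  (forall w, is_composition n (X w)) /\
  (forall c : seq nat, measurable (X @^-1` [set c])).

Variable C : nat -> T -> seq nat.

Definition markovian : Prop :=
  forall (n : nat) (c : nat -> seq nat), (1 <= n)%N ->
    let past := [set w | forall k, (1 <= k <= n)%N -> C k w = c k] in
    P past != 0%E ->
    cond_prob (C n.+1 @^-1` [set c n.+1]) past =
    cond_prob (C n.+1 @^-1` [set c n.+1]) (C n @^-1` [set c n]).

Definition sampling_consistent : Prop :=
  forall (n : nat) (c c' : seq nat), (1 <= n)%N ->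
    P (C n.+1 @^-1` [set c]) != 0%E ->
    cond_prob (C n @^-1` [set c']) (C n.+1 @^-1` [set c]) =
    #|[set b : 'I_n.+1 | discard_ball c b == c']%SET|%:R / n.+1%:R.

(* The sequence is indexed by n >= 1; [C 0] is left unconstrained. *)
Definition composition_structure : Prop :=
  [/\ forall n, (1 <= n)%N -> random_composition n (C n),
      markovian & sampling_consistent].

Definition first_part_is (n m : nat) : set T :=
  [set w | head 0%N (C n w) = m].

Definition regenerative : Prop :=
  forall n m : nat, (1 <= m < n)%N -> P (first_part_is n m) != 0%E ->
    forall c : seq nat,
      cond_prob [set w | behead (C n w) = c] (first_part_is n m) =
      fine (P (C (n - m)%N @^-1` [set c])).

Definition is_decrement_matrix (q : nat -> nat -> R) : Prop :=
  forall n m : nat, (1 <= m <= n)%N -> P (first_part_is n m) = (q n m)%:E.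

End RandomCompositions.

(* Main.v *)
(* Regeneration forces the law of C_n to be the product
   p_n(c) = q(n : c_1) q(n - c_1 : c_2) ..., and summing sampling consistency
   over the compositions with a given first part yields the recursion.
   Conversely, the recursion implies, by induction on n, that the product laws
   p_{n+1} and p_n are linked by the discarding of a uniform ball: the discarded
   ball is in the first box, or the problem is reduced to the remaining
   composition. This prescribes consistent joint laws for (C_n, C_{n+1}), hence
   a Markov chain, which is realised on [0, 1[ with Lebesgue measure by nested
   partitions into intervals. *)
Require Import Defs.
From HB Require Import structures.
From mathcomp Require Import all_boot all_order all_algebra.
From mathcomp Require Import all_classical all_reals all_analysis.
From mathcomp Require Import zify ring lra.
Import Order.TTheory GRing.Theory Num.Theory.
Local Open Scope ring_scope.

(** * Compositions and ball discarding *)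

Lemma reshape_index_cons (m : nat) (c : seq nat) (b : nat) :
  reshape_index (m :: c) b =
    (if b < m then 0 else (reshape_index c (b - m)).+1)%N.
Proof.
rewrite /reshape_index /= subn_eq0; case: ltnP => //= lemb.
by rewrite subSn.
Qed.

Lemma filter_gt0_composition (n : nat) (c : seq nat) :
  is_composition n c -> [seq k <- c | (0 < k)%N] = c.
Proof. by case/andP=> /all_filterP. Qed.

Lemma is_composition_cons (n m : nat) (c : seq nat) :
  is_composition n (m :: c) =
    [&& (0 < m)%N, (m <= n)%N & is_composition (n - m) c].
Proof. by rewrite /is_composition /=; case: (all _ _) => /=; lia. Qed.

Lemma discard_ball_first (n m : nat) (c : seq nat) (b : nat) :
  is_composition n c -> (b < m)%N ->
  discard_ball (m :: c) b = if m == 1%N then c else m.-1 :: c.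
Proof.
move=> cc ltbm; rewrite /discard_ball reshape_index_cons ltbm /=.
rewrite (filter_gt0_composition _ _ cc).
by case: m ltbm => [|[|m]].
Qed.

Lemma discard_ball_rest (m : nat) (c : seq nat) (b : nat) :
  (0 < m)%N -> (m <= b)%N ->
  discard_ball (m :: c) b = m :: discard_ball c (b - m).
Proof.
move=> m_gt0 lemb.
by rewrite /discard_ball reshape_index_cons ltnNge lemb /= m_gt0.
Qed.

Lemma discard_ball_composition (n : nat) (c : seq nat) (b : nat) :
  is_composition n.+1 c -> (b < n.+1)%N -> is_composition n (discard_ball c b).
Proof.
elim: c n b => [|m c IHc] n b; first by rewrite /is_composition.
rewrite is_composition_cons => /and3P[m_gt0 lemn cc] ltbn.
case: (ltnP b m) => [ltbm|lemb].
  rewrite (discard_ball_first _ _ _ _ cc ltbm).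
  case: eqP cc => [->|m_neq1]; first by rewrite subn1.
  rewrite is_composition_cons => cc.
  by apply/and3P; split; try lia; rewrite (_ : n - m.-1 = n.+1 - m)%N; last lia.
rewrite discard_ball_rest // is_composition_cons m_gt0 /=.
have lemn' : (m <= n)%N by lia.
rewrite lemn' IHc //; last by lia.
by rewrite -subSn.
Qed.

(** The recursive call on [n - m] is not structural, so a fuel [k] bounds the number of parts; any
    [k >= n] gives the full list. *)
Fixpoint compositions_fuel (k n : nat) : seq (seq nat) :=
  if k is k'.+1 then
    if n == 0%N then [:: [::]]
    else [seq m :: c | m <- iota 1 n, c <- compositions_fuel k' (n - m)]
  else [:: [::]].

Definition compositions (n : nat) : seq (seq nat) := compositions_fuel n n.

Lemma is_composition0 (c : seq nat) : is_composition 0 c = (c == [::]).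
Proof. by case: c => // m c; rewrite is_composition_cons; case: m. Qed.

Lemma mem_compositions_fuel (k n : nat) (c : seq nat) :
  (n <= k)%N -> (c \in compositions_fuel k n) = is_composition n c.
Proof.
elim: k n c => [|k IHk] n c /=.
  by rewrite leqn0 => /eqP ->; rewrite is_composition0 inE.
move=> lenk; case: eqP => [->|/eqP n_neq0].
  by rewrite is_composition0 inE.
apply/allpairsPdep/idP => [[m [c' [+ + ->]]]|].
  rewrite mem_iota => m_bnd; rewrite IHk; last by lia.
  by rewrite is_composition_cons => ->; lia.
case: c => [|m c]; first by rewrite /is_composition /= eq_sym (negbTE n_neq0).
rewrite is_composition_cons => /and3P[m_gt0 lemn cc].
by exists m, c; split; rewrite // ?mem_iota ?IHk //; lia.
Qed.

Lemma mem_compositions (n : nat) (c : seq nat) :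
  (c \in compositions n) = is_composition n c.
Proof. exact: mem_compositions_fuel. Qed.

Lemma uniq_compositions_fuel (k n : nat) : uniq (compositions_fuel k n).
Proof.
elim: k n => [|k IHk] n //=; case: eqP => // _.
apply: allpairs_uniq_dep; rewrite ?iota_uniq //.
by move=> [m c] [m' c'] _ _ /= [-> ->].
Qed.

Lemma uniq_compositions (n : nat) : uniq (compositions n).
Proof. exact: uniq_compositions_fuel. Qed.

(** The left side builds its tails with fuel [n], the right side with fuel [n.+1 - m]. Comparing
    members avoids proving independence of the fuel, and sums do not see the order. *)
Lemma perm_compositionsS (n : nat) :
  perm_eq (compositions n.+1)
    [seq m :: c | m <- iota 1 n.+1, c <- compositions (n.+1 - m)].
Proof.
apply: uniq_perm; first exact: uniq_compositions.
  apply: allpairs_uniq_dep; rewrite ?iota_uniq //.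
    by move=> m _; exact: uniq_compositions.
  by move=> [m c] [m' c'] _ _ /= [-> ->].
move=> c; rewrite mem_compositions; apply/idP/allpairsPdep.
  case: c => // m c; rewrite is_composition_cons => /and3P[m_gt0 lemn cc].
  by exists m, c; rewrite mem_iota mem_compositions; split=> //; lia.
move=> [m [c' [+ + ->]]]; rewrite mem_iota mem_compositions => m_bnd.
by rewrite is_composition_cons => ->; lia.
Qed.

(** * Product laws on compositions and the action of discarding a ball *)

Section CompositionLaw.
Context {R : realType}.
Variable q : nat -> nat -> R.

(** The size is read off as [sumn c], so the same function serves for every [n] and restricts to the
    tail of a composition. *)
Fixpoint comp_law (c : seq nat) : R :=
  if c is m :: c' then q (sumn c) m * comp_law c' else 1.

Definition comp_expect (n : nat) (f : seq nat -> R) : R :=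
  \sum_(c <- compositions n) comp_law c * f c.

(** For [c] of size [n.+1] this is [n.+1] times the mean of [f] after discarding a uniform ball;
    leaving out the normalisation avoids divisions. *)
Definition discard_sum (f : seq nat -> R) (c : seq nat) : R :=
  \sum_(0 <= b < sumn c) f (discard_ball c b).

Lemma comp_law_ge0 (n : nat) (c : seq nat) :
  (forall n m : nat, (1 <= m <= n)%N -> 0 <= q n m) ->
  is_composition n c -> 0 <= comp_law c.
Proof.
move=> q_ge0; elim: c n => [|m c IHc] n //=.
rewrite is_composition_cons => /and3P[m_gt0 _ cc].
by rewrite mulr_ge0 ?(IHc _ cc) // q_ge0 //; lia.
Qed.

Lemma eq_comp_expect (n : nat) (f g : seq nat -> R) :
  (forall c, is_composition n c -> f c = g c) ->
  comp_expect n f = comp_expect n g.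
Proof.
move=> fg; rewrite /comp_expect !big_seq; apply: eq_bigr => c.
by rewrite mem_compositions => /fg ->.
Qed.

Lemma comp_expectD (n : nat) (f g : seq nat -> R) :
  comp_expect n (fun c => f c + g c) = comp_expect n f + comp_expect n g.
Proof.
by rewrite /comp_expect -big_split; apply: eq_bigr => c _; rewrite mulrDr.
Qed.

Lemma comp_expectZ (n : nat) (a : R) (f : seq nat -> R) :
  comp_expect n (fun c => a * f c) = a * comp_expect n f.
Proof. by rewrite /comp_expect mulr_sumr; apply: eq_bigr => c _; ring. Qed.

Lemma comp_expect0 (f : seq nat -> R) : comp_expect 0 f = f [::].
Proof. by rewrite /comp_expect big_seq1 mul1r. Qed.

Lemma comp_expectS (n : nat) (f : seq nat -> R) :
  comp_expect n.+1 f =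
  \sum_(1 <= m < n.+2) q n.+1 m * comp_expect (n.+1 - m) (fun c => f (m :: c)).
Proof.
rewrite /comp_expect (perm_big _ (perm_compositionsS n)) big_allpairs_dep /=.
rewrite /index_iota subSS subn0 !big_seq; apply: eq_bigr => m.
rewrite -[_ :: _]/(iota 1 n.+1) mem_iota => m_bnd.
rewrite mulr_sumr !big_seq; apply: eq_bigr => c.
rewrite mem_compositions => /andP[_ /eqP sumc] /=.
by rewrite sumc subnKC ?mulrA //; lia.
Qed.

Lemma discard_sum_cons (n m : nat) (c : seq nat) (f : seq nat -> R) :
  (0 < m)%N -> is_composition n c ->
  discard_sum f (m :: c) =
    m%:R * f (if m == 1%N then c else m.-1 :: c)
    + discard_sum (fun c' => f (m :: c')) c.
Proof.
move=> m_gt0 cc; rewrite /discard_sum /=.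
rewrite (@big_cat_nat _ _ _ m) /=; [|lia..]; congr (_ + _).
  rewrite (eq_big_nat _ _ (F2 := fun=> f (if m == 1%N then c else m.-1 :: c))).
    by rewrite sumr_const_nat subn0 mulr_natl.
  by move=> b ltbm; rewrite (discard_ball_first _ _ _ _ cc).
rewrite -{1}(add0n m) big_addn addKn; apply: eq_bigr => b _.
by rewrite discard_ball_rest ?addnK ?leq_addl.
Qed.

Lemma discard_sum_const (c : seq nat) (a : R) :
  discard_sum (fun=> a) c = (sumn c)%:R * a.
Proof. by rewrite /discard_sum sumr_const_nat subn0 mulr_natl. Qed.

(** Split on the first part and on whether the ball lies in the first box. A singleton first box
    vanishes, which gives the term in [q n.+1 1]; a first part [m.+1] drops to [m]; otherwise the
    first part stays and the ball comes from the rest. *)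
Lemma comp_expect_discard_sum (n : nat) (f : seq nat -> R) :
  (0 < n)%N ->
  comp_expect n.+1 (discard_sum f) =
  q n.+1 1%N * comp_expect n f +
  \sum_(1 <= m < n.+1)
    (m.+1%:R * q n.+1 m.+1 * comp_expect (n - m) (fun c => f (m :: c))
     + q n.+1 m *
       comp_expect (n.+1 - m) (discard_sum (fun c => f (m :: c)))).
Proof.
move=> n_gt0; rewrite comp_expectS.
pose g m := m%:R * q n.+1 m *
  comp_expect (n.+1 - m) (fun c => f (if m == 1%N then c else m.-1 :: c)).
pose h m := q n.+1 m *
  comp_expect (n.+1 - m) (discard_sum (fun c => f (m :: c))).
rewrite (eq_big_nat _ _ (F2 := fun m => g m + h m)); last first.
  move=> m m_bnd; rewrite /g /h.
  rewrite (eq_comp_expect _ _ (fun c =>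
    m%:R * f (if m == 1%N then c else m.-1 :: c)
    + discard_sum (fun c' => f (m :: c')) c)); last first.
    by move=> c cc; rewrite (discard_sum_cons _ _ _ _ _ cc) //; lia.
  by rewrite comp_expectD comp_expectZ; ring.
(* The sum of [g] gives up its term at 1 (the vanishing box) and is shifted; the sum of [h] loses
   its term at [n.+1], whose rest has no ball. Both then run over [1 <= m < n.+1]. *)
rewrite !big_split /= big_nat_recl //.
rewrite [X in _ + X]big_nat_recr //= -!addrA; congr (_ + _).
  by rewrite /g mul1r subn1.
rewrite {2}/h subnn comp_expect0 [discard_sum _ _]big_nil mulr0 addr0.
congr (_ + _); rewrite !big_nat; apply: eq_bigr => -[//|m] _.
by rewrite /g subSS.
Qed.

End CompositionLaw.

(** * Equivalence of the recursion with consistency of the product laws *)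

Section DecrementRecursion.
Context {R : realType}.
Variable q : nat -> nat -> R.

Definition decrement_recursion : Prop :=
  forall n m : nat, (1 <= m <= n)%N ->
    q n m = m.+1%:R / n.+1%:R * q n.+1 m.+1
            + (n.+1 - m)%N%:R / n.+1%:R * q n.+1 m
            + n.+1%:R^-1 * q n.+1 1%N * q n m.

Lemma decrement_recursionE (n m : nat) :
  (q n m = m.+1%:R / n.+1%:R * q n.+1 m.+1
           + (n.+1 - m)%N%:R / n.+1%:R * q n.+1 m
           + n.+1%:R^-1 * q n.+1 1%N * q n m) <->
  (n.+1%:R * q n m = m.+1%:R * q n.+1 m.+1 + (n.+1 - m)%N%:R * q n.+1 m
                     + q n.+1 1%N * q n m).
Proof.
have n1_neq0 : n.+1%:R != 0 :> R by rewrite pnatr_eq0.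
split=> [qnm|qnm]; first by rewrite {1}qnm; field.
by apply: (mulfI n1_neq0); rewrite qnm; field.
Qed.

(** Strong induction on [n]: the induction hypothesis handles discards inside the rest, and the
    recursion then matches the coefficients for each first part [m]. *)
Lemma comp_expect_discard (n : nat) (f : seq nat -> R) :
  q 1%N 1%N = 1 -> decrement_recursion ->
  comp_expect q n.+1 (discard_sum f) = n.+1%:R * comp_expect q n f.
Proof.
move=> q11 qrec; elim/ltn_ind: n f => -[|n] IHn f.
  rewrite comp_expectS big_nat1 q11 !comp_expect0 /discard_sum big_nat1.
  by rewrite mul1r.
rewrite comp_expect_discard_sum //.
(* The vanishing first box already contributes [q n.+2 1] times the target expectation, so the sum
   must supply the remaining coefficient. *)
rewrite [X in _ + X](_ : _ = (n.+2%:R - q n.+2 1%N) * comp_expect q n.+1 f).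
  by rewrite mulrBl addrC subrK.
rewrite [in RHS]comp_expectS mulr_sumr !big_nat; apply: eq_bigr => m m_bnd.
rewrite (_ : n.+2 - m = (n.+1 - m).+1)%N; last by lia.
rewrite IHn; last by lia.
have /decrement_recursionE := qrec n.+1 m m_bnd.
rewrite (_ : n.+2 - m = (n.+1 - m).+1)%N; last by lia.
by move=> qE; rewrite !mulrA -mulrDl; congr (_ * _); rewrite mulrBl qE; ring.
Qed.

(** Testing consistency against the constant 1 shows that the total mass is the same at sizes [n]
    and [n.+1]; this is how the product laws get normalised. *)
Lemma comp_expect1 (n : nat) :
  q 1%N 1%N = 1 -> decrement_recursion -> comp_expect q n (fun=> 1) = 1.
Proof.
move=> q11 qrec; elim: n => [|n IHn]; first by rewrite comp_expect0.
have := comp_expect_discard n (fun=> 1) q11 qrec; rewrite IHn.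
rewrite (eq_comp_expect _ _ _ (fun=> n.+1%:R * 1)) => [|c /andP[_ /eqP sumc]].
  by rewrite comp_expectZ => /mulfI -> //; rewrite pnatr_eq0.
by rewrite discard_sum_const sumc.
Qed.

Lemma comp_expect_zero (n : nat) : comp_expect q n (fun=> 0) = 0.
Proof. by rewrite /comp_expect big1 // => c _; rewrite mulr0. Qed.

Lemma comp_expect_head (n m : nat) :
  (forall k, comp_expect q k (fun=> 1) = 1) -> (1 <= m <= n)%N ->
  comp_expect q n (fun c => (head 0%N c == m)%:R) = q n m.
Proof.
move=> mass m_bnd; case: n m_bnd => [|n] m_bnd; first by lia.
rewrite comp_expectS /= (bigD1_seq m) ?iota_uniq ?mem_index_iota //=.
rewrite eqxx mass mulr1 big1_seq ?addr0 // => k /andP[/negbTE neq_km _].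
by rewrite neq_km comp_expect_zero mulr0.
Qed.

(** The indicator that the first part is [m] is the right test function: in the split by first part
    only the term at [m] survives, and it is the recursion. *)
Lemma decrement_recursion_of_mass1 :
  (forall n, comp_expect q n (fun=> 1) = 1) ->
  (forall n m, (1 <= m <= n)%N ->
     comp_expect q n.+1 (discard_sum (fun c => (head 0%N c == m)%:R)) =
     n.+1%:R * comp_expect q n (fun c => (head 0%N c == m)%:R)) ->
  decrement_recursion.
Proof.
move=> mass consistent n m m_bnd; apply/decrement_recursionE.
have n_gt0 : (0 < n)%N by lia.
have := consistent n m m_bnd; rewrite comp_expect_head // => <-.
rewrite comp_expect_discard_sum // comp_expect_head // addrC; congr (_ + _).
rewrite (bigD1_seq m) ?iota_uniq ?mem_index_iota //= eqxx.
rewrite big1_seq => [|k /andP[/negbTE neq_km _]].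
  (* Discarding outside the first box keeps the first part, so the inner [discard_sum] is constant,
     equal to the [n.+1 - m] balls of the rest. *)
  rewrite mass addr0 mulr1 (eq_comp_expect _ _ _ (fun=> (n.+1 - m)%:R * 1)).
    by rewrite comp_expectZ mass; ring.
  by move=> c /andP[_ /eqP sumc]; rewrite discard_sum_const sumc.
rewrite neq_km.
rewrite comp_expect_zero (eq_comp_expect _ _ _ (fun=> 0)) ?comp_expect_zero.
  by rewrite !mulr0 addr0.
by move=> c _; rewrite discard_sum_const mulr0.
Qed.

End DecrementRecursion.

(** * Markov chains with prescribed consecutive joint laws *)

Section PickByWeight.
Context {R : realType} {S : eqType}.
Variables (w : S -> R) (x0 : S).

(** Consecutive intervals of lengths [w x] are laid out from 0, and the label of the one containing
    [t] is returned; for nonnegative [t] and weights, [x0] appears only beyond the total weight.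
    [weight_before] gives the left endpoints. *)
Fixpoint pick_weight (e : seq S) (t : R) : S :=
  if e is x :: e' then if t < w x then x else pick_weight e' (t - w x) else x0.

Fixpoint weight_before (e : seq S) (x : S) : R :=
  if e is y :: e' then if y == x then 0 else w y + weight_before e' x else 0.

Lemma weight_before_ge0 (e : seq S) (x : S) :
  {in e, forall y, 0 <= w y} -> 0 <= weight_before e x.
Proof.
elim: e => //= y e IHe w_ge0; case: eqP => // _.
rewrite addr_ge0 ?w_ge0 ?mem_head // IHe // => z ze.
by rewrite w_ge0 // in_cons ze orbT.
Qed.

Lemma weight_before_le (e : seq S) (x : S) :
  {in e, forall y, 0 <= w y} -> x \in e ->
  weight_before e x + w x <= \sum_(y <- e) w y.
Proof.
elim: e => //= y e IHe w_ge0; rewrite in_cons big_cons.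
have w_ge0' : {in e, forall z, 0 <= w z}.
  by move=> z ze; rewrite w_ge0 // in_cons ze orbT.
case: (eqVneq y x) => [-> _|neq_yx].
  by rewrite add0r lerDl big_seq sumr_ge0.
by move=> /= /IHe; rewrite -addrA lerD2l => ->.
Qed.

Lemma mem_pick_weight (e : seq S) (t : R) :
  0 <= t < \sum_(y <- e) w y -> pick_weight e t \in e.
Proof.
elim: e t => [|y e IHe] t /=; first by rewrite big_nil; lra.
rewrite big_cons => t_bnd; case: ltP => [_|ltyt]; first exact: mem_head.
by rewrite in_cons IHe ?orbT //; lra.
Qed.

Lemma pick_weight_bounds (e : seq S) (t : R) :
  uniq e -> 0 <= t < \sum_(y <- e) w y ->
  weight_before e (pick_weight e t) <= t <
    weight_before e (pick_weight e t) + w (pick_weight e t).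
Proof.
elim: e t => [|y e IHe] t /=; first by rewrite big_nil; lra.
rewrite big_cons => /andP[ye uniq_e] t_bnd; case: ltP => [lt_ty|le_yt].
  by rewrite eqxx; lra.
have t_bnd' : 0 <= t - w y < \sum_(z <- e) w z by lra.
(* If the tail could return [y] again, [weight_before] would stop too early; [uniq e] excludes
   this. *)
case: eqP => [eq_y|_]; last by have := IHe _ uniq_e t_bnd'; lra.
by rewrite eq_y (mem_pick_weight _ _ t_bnd') in ye.
Qed.

Lemma pick_weight_eq (e : seq S) (x : S) (t : R) :
  {in e, forall y, 0 <= w y} -> x \in e ->
  weight_before e x <= t < weight_before e x + w x -> pick_weight e t = x.
Proof.
elim: e t => //= y e IHe t w_ge0; rewrite in_cons.
have w_ge0' : {in e, forall z, 0 <= w z}.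
  by move=> z ze; rewrite w_ge0 // in_cons ze orbT.
case: (eqVneq y x) => [->|neq_yx]; first by rewrite add0r => _ /andP[_ ->].
move=> /= xe t_bnd.
have before_ge0 := weight_before_ge0 e x w_ge0'.
by rewrite ltNge (_ : w y <= t) /= ?IHe //; lra.
Qed.

End PickByWeight.

(** * The uniform probability on the unit interval *)

Section UniformMeasure.
Variable R : realType.

(** The sample space is the whole real line, with Lebesgue measure restricted to [[0, 1[]; points
    outside form a null set. *)
Definition unit_itv_measure : set _ -> \bar R :=
  mrestr (@lebesgue_measure R) (measurable_itv `[0, 1[).

HB.instance Definition _ := Measure.on unit_itv_measure.

Lemma unit_itv_measure_setT : unit_itv_measure setT = 1%E.
Proof.
by rewrite /unit_itv_measure /mrestr setTI lebesgue_measure_itv /= lte01 sube0.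
Qed.

HB.instance Definition _ := @Measure_isProbability.Build _ _ R
  unit_itv_measure unit_itv_measure_setT.

End UniformMeasure.

(** * Nested interval partitions realising a consistent family of path weights *)

Section Histories.
Context {R : realType} {S : choiceType}.
Variables (E : nat -> seq S) (x0 : S).

(* Histories list the visited states, most recent first. *)
Fixpoint is_history (h : seq S) : bool :=
  if h is x :: h' then (x \in E (size h')) && is_history h' else true.

Fixpoint histories (n : nat) : seq (seq S) :=
  if n is n'.+1 then [seq x :: h | x <- E n', h <- histories n'] else [:: [::]].

Lemma mem_histories (n : nat) (h : seq S) :
  (h \in histories n) = (size h == n) && is_history h.
Proof.
elim: n h => [|n IHn] h; first by rewrite inE; case: h.
apply/allpairsP/idP => [[[x h'] /= [xE + ->]]|].
  by rewrite IHn => /andP[/eqP sz hh] /=; rewrite sz eqxx hh xE.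
case: h => //= x h; rewrite eqSS => /and3P[/eqP sz xE hh].
by exists (x, h); rewrite IHn -sz eqxx hh.
Qed.

Hypothesis uniq_E : forall n, uniq (E n).

Lemma uniq_histories (n : nat) : uniq (histories n).
Proof.
elim: n => //= n IHn; apply: allpairs_uniq => // -[x h] [x' h'] _ _ /=.
by case=> -> ->.
Qed.

Variable W : seq S -> R.
Hypothesis W_nil : W [::] = 1.
Hypothesis W_ge0 : forall h, is_history h -> 0 <= W h.
Hypothesis W_sum : forall h, is_history h ->
  \sum_(x <- E (size h)) W (x :: h) = W h.

(* The histories of length [n] cut [0, 1[ into consecutive intervals of
   lengths [W h], each level refining the previous one. *)
Fixpoint history_start (h : seq S) : R :=
  if h is x :: h' then
    history_start h' + weight_before (fun y => W (y :: h')) (E (size h')) x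
  else 0.

Fixpoint history_at (n : nat) (t : R) : seq S :=
  if n is n'.+1 then
    let h := history_at n' t in
    pick_weight (fun y => W (y :: h)) x0 (E n') (t - history_start h) :: h
  else [::].

Let W_ge0_in (h : seq S) : is_history h ->
  {in E (size h), forall y, 0 <= W (y :: h)}.
Proof. by move=> hh y yE; rewrite W_ge0 //= yE. Qed.

Lemma size_history_at (n : nat) (t : R) : size (history_at n t) = n.
Proof. by elim: n => //= n ->. Qed.

(** By [W_sum] the children of a history exactly fill its interval, so the offset
    [t - history_start h] always stays in the range of [pick_weight]. *)
Lemma history_at_bounds (n : nat) (t : R) : 0 <= t < 1 ->
  let h := history_at n t in
  is_history h /\ history_start h <= t < history_start h + W h.
Proof.
move=> t_bnd; elim: n => [|n [hh h_bnd]] /=; first by rewrite W_nil; lra.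
set h := history_at n t in hh h_bnd *.
have sz : size h = n by exact: size_history_at.
have t_bnd' : 0 <= t - history_start h < \sum_(y <- E n) W (y :: h).
  by rewrite -[in E n]sz W_sum //; lra.
rewrite sz hh andbT mem_pick_weight //; split=> //.
by have := pick_weight_bounds _ x0 _ _ (uniq_E n) t_bnd'; lra.
Qed.

Lemma history_start_bounds (h : seq S) : is_history h ->
  0 <= history_start h /\ history_start h + W h <= 1.
Proof.
elim: h => [|x h IHh] /=; first by rewrite W_nil add0r.
case/andP=> xE hh; have [ge0 le1] := IHh hh.
have := weight_before_ge0 _ _ x (W_ge0_in h hh).
by have := weight_before_le _ _ x (W_ge0_in h hh) xE; rewrite W_sum //; lra.
Qed.

Lemma history_at_interval (h : seq S) (t : R) : is_history h ->
  history_start h <= t < history_start h + W h -> history_at (size h) t = h.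
Proof.
elim: h => //= x h IHh /andP[xE hh] t_bnd.
have := weight_before_ge0 _ _ x (W_ge0_in h hh).
have := weight_before_le _ _ x (W_ge0_in h hh) xE; rewrite W_sum //.
move=> leW ge0; rewrite IHh //; last by lra.
by rewrite (pick_weight_eq _ _ _ _ _ (W_ge0_in h hh) xE) //; lra.
Qed.

(** Points outside [[0, 1[] are sent to 0 so that every sample point, not just almost every one,
    yields a valid history. *)
Definition clip_unit (t : R) : R := if 0 <= t < 1 then t else 0.

Lemma clip_unit_bounds (t : R) : 0 <= clip_unit t < 1.
Proof. by rewrite /clip_unit; case: ifP => // _; rewrite lexx ltr01. Qed.

Definition random_history (n : nat) (t : R) : seq S :=
  history_at n (clip_unit t).

Lemma random_historyS (n : nat) (t : R) :
  random_history n.+1 t =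
    head x0 (random_history n.+1 t) :: random_history n t.
Proof. by []. Qed.

Lemma size_random_history (n : nat) (t : R) : size (random_history n t) = n.
Proof. exact: size_history_at. Qed.

Lemma mem_random_history (n : nat) (t : R) :
  random_history n t \in histories n.
Proof.
rewrite mem_histories size_random_history eqxx.
by have [] := history_at_bounds n _ (clip_unit_bounds t).
Qed.

Local Open Scope classical_set_scope.

(** Inside [[0, 1[] the level set is the interval of [h]. All clipped points share the history of 0,
    so the outside is contained in the level set or disjoint from it. *)
Lemma random_history_preimage (h : seq S) : is_history h ->
  random_history (size h) @^-1` [set h] =
  `[history_start h, history_start h + W h[ `|`
  (~` `[0, 1[ `&` [set _ | history_at (size h) 0 = h]).
Proof.
move=> hh; have [ge0 le1] := history_start_bounds h hh.
apply/seteqP; split=> t /=; rewrite !in_itv /= /random_history /clip_unit.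
  case: ifP => [t_bnd|t_out]; last by right.
  by have [_ +] := history_at_bounds (size h) t t_bnd => + th; rewrite th; left.
case=> [t_bnd|[/negP/negbTE -> //]].
by rewrite ifT; [exact: history_at_interval|lra].
Qed.

Lemma measurable_random_history1 (h : seq S) : is_history h ->
  measurable (random_history (size h) @^-1` [set h]).
Proof.
move=> hh; rewrite random_history_preimage //.
apply: measurableU; first exact: measurable_itv.
apply: measurableI; first by apply: measurableC; exact: measurable_itv.
case: (eqVneq (history_at (size h) 0) h) => [eqh|neqh].
  by rewrite (_ : [set _ | _] = setT) //; apply/seteqP; split.
rewrite (_ : [set _ | _] = set0) //.
by apply/seteqP; split=> // t /= /eqP; rewrite (negbTE neqh).
Qed.

Lemma random_history1_prob (h : seq S) : is_history h ->
  unit_itv_measure R (random_history (size h) @^-1` [set h]) = (W h)%:E.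
Proof.
move=> hh; rewrite random_history_preimage // /unit_itv_measure /mrestr.
have [ge0 le1] := history_start_bounds h hh.
rewrite (_ : _ `&` _ = `[history_start h, history_start h + W h[).
  (* The length formula applies to a nondegenerate interval; in the other case [W h] is 0. *)
  rewrite lebesgue_measure_itv /= lte_fin ltrDl; case: ltP => [_|le0].
    by rewrite -EFinB addrAC subrr add0r.
  by congr _%:E; apply/eqP; rewrite eq_le le0 W_ge0.
apply/seteqP; split=> t /=; rewrite !in_itv /=; first by case=> -[//|[]].
by move=> t_bnd; split; [left|lra].
Qed.

Lemma random_history_preimageE (n : nat) (Q : pred (seq S)) :
  random_history n @^-1` [set` Q] =
  \bigcup_(h in [set` [seq h <- histories n | Q h]])
    (random_history (size h) @^-1` [set h]).
Proof.
apply/seteqP; split=> t /=.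
  move=> Qt; exists (random_history n t).
    by rewrite /= mem_filter mem_random_history andbT.
  by rewrite /= size_random_history.
case=> h /=; rewrite mem_filter mem_histories => /and3P[Qh /eqP -> hh].
by move=> ->.
Qed.

Lemma measurable_random_history (n : nat) (Q : pred (seq S)) :
  measurable (random_history n @^-1` [set` Q]).
Proof.
rewrite random_history_preimageE; apply: fin_bigcup_measurable.
  exact: finite_seq.
move=> h /=; rewrite mem_filter mem_histories => /and3P[_ _ hh].
exact: measurable_random_history1.
Qed.

Lemma random_history_prob (n : nat) (Q : pred (seq S)) :
  unit_itv_measure R (random_history n @^-1` [set` Q]) =
  (\sum_(h <- histories n | Q h) W h)%:E.
Proof.
rewrite random_history_preimageE measure_fin_bigcup.
- rewrite -fsbig_seq ?filter_uniq ?uniq_histories // -sumEFin big_filter.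
  rewrite big_seq_cond [RHS]big_seq_cond; apply: eq_bigr => h /andP[].
  rewrite mem_histories => /andP[_ hh] _.
  exact: random_history1_prob.
- exact: finite_seq.
- move=> h h' /=; rewrite !mem_filter !mem_histories.
  move=> /and3P[_ /eqP szh _] /and3P[_ /eqP szh' _] [t [/= + +]].
  by rewrite szh szh' => -> ->.
- move=> h /=; rewrite mem_filter mem_histories => /and3P[_ _ hh].
  exact: measurable_random_history1.
Qed.

End Histories.

(** * A Markov chain built from the joint laws of consecutive states *)

Section MarkovChain.
Context {R : realType} {S : choiceType}.
Variables (E : nat -> seq S) (x0 : S).
Variables (mu : nat -> S -> R) (J : nat -> S -> S -> R).
Hypothesis uniq_E : forall n, uniq (E n).
Hypothesis J_ge0 :
  forall n x y, x \in E n -> y \in E n.+1 -> 0 <= J n x y.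
Hypothesis mu0_ge0 : forall x, x \in E 0 -> 0 <= mu 0 x.
Hypothesis mu0_sum : \sum_(x <- E 0) mu 0 x = 1.
Hypothesis J_fst :
  forall n x, x \in E n -> \sum_(y <- E n.+1) J n x y = mu n x.
Hypothesis J_snd :
  forall n y, y \in E n.+1 -> \sum_(x <- E n) J n x y = mu n.+1 y.

(** Initial law times the transition probabilities [J / mu]. Division by zero gives 0, so a state of
    mass 0 has no outgoing weight. *)
Fixpoint chain_weight (h : seq S) : R :=
  match h with
  | [::] => 1
  | [:: x] => mu 0 x
  | y :: ((x :: h'') as h') =>
      chain_weight h' * (J (size h'') x y / mu (size h'') x)
  end.

Lemma chain_weightS (y x : S) (h : seq S) :
  chain_weight [:: y, x & h] =
    chain_weight (x :: h) * (J (size h) x y / mu (size h) x).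
Proof. by []. Qed.

Lemma chain_mu_ge0 (n : nat) (x : S) : x \in E n -> 0 <= mu n x.
Proof.
by move=> xE; rewrite -J_fst // big_seq sumr_ge0 // => y yE; exact: J_ge0.
Qed.

Lemma chain_weight_ge0 (h : seq S) : is_history E h -> 0 <= chain_weight h.
Proof.
elim: h => // y [|x h] IHh; first by rewrite /= andbT; exact: mu0_ge0.
move=> /andP[yE hh]; rewrite chain_weightS mulr_ge0 ?IHh //.
by case/andP: hh => xE _; rewrite divr_ge0 ?J_ge0 ?chain_mu_ge0.
Qed.

(** Nonnegative terms with sum 0 all vanish. Hence [mu n x * (J n x y / mu n x)] is [J n x y] even
    when the denominator is 0. *)
Lemma joint_eq0_fst (n : nat) (x y : S) :
  x \in E n -> y \in E n.+1 -> mu n x = 0 -> J n x y = 0.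
Proof.
move=> xE yE mu0; have := J_fst n x xE; rewrite mu0 (bigD1_seq y) //=.
move=> /eqP; rewrite paddr_eq0 ?J_ge0 //; first by case/andP=> /eqP.
by rewrite big_seq_cond sumr_ge0 // => z /andP[zE _]; exact: J_ge0.
Qed.

Lemma joint_eq0_snd (n : nat) (x y : S) :
  x \in E n -> y \in E n.+1 -> mu n.+1 y = 0 -> J n x y = 0.
Proof.
move=> xE yE mu0; have := J_snd n y yE; rewrite mu0 (bigD1_seq x) //=.
move=> /eqP; rewrite paddr_eq0 ?J_ge0 //; first by case/andP=> /eqP.
by rewrite big_seq_cond sumr_ge0 // => z /andP[zE _]; exact: J_ge0.
Qed.

Lemma chain_weight_eq0 (x : S) (h : seq S) :
  is_history E (x :: h) -> mu (size h) x = 0 -> chain_weight (x :: h) = 0.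
Proof.
case: h => //= y h /andP[xE /andP[yE _]] mu0.
by rewrite joint_eq0_snd // mul0r mulr0.
Qed.

(** From a state of positive mass the transitions sum to 1 by [J_fst]; a history ending in a state
    of mass 0 has weight 0 already. *)
Lemma chain_weight_sum (h : seq S) : is_history E h ->
  \sum_(y <- E (size h)) chain_weight (y :: h) = chain_weight h.
Proof.
case: h => [_|x h hh]; first exact: mu0_sum.
rewrite (eq_bigr _ (fun y _ => chain_weightS y x h)) -mulr_sumr -mulr_suml.
rewrite J_fst; last by case/andP: hh.
case: (eqVneq (mu (size h) x) 0) => [mu0|mu_neq0]; last by rewrite divff ?mulr1.
by rewrite chain_weight_eq0 // mul0r.
Qed.

(** Induction on time: summing over the past of the previous state [x] gives [mu n x], which cancels
    the denominator, and [J_snd] sums over [x]. *)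
Lemma chain_weight_marginal (n : nat) (y : S) : y \in E n ->
  \sum_(h <- histories E n) chain_weight (y :: h) = mu n y.
Proof.
elim: n y => [|n IHn] y yE; first by rewrite big_seq1.
rewrite [histories _ _]/= big_allpairs_dep -J_snd // !big_seq.
apply: eq_bigr => x xE.
transitivity (\sum_(h <- histories E n) chain_weight (x :: h)
              * (J n x y / mu n x)).
  rewrite !big_seq; apply: eq_bigr => h; rewrite mem_histories.
  by case/andP=> /eqP <- _.
rewrite -mulr_suml IHn //.
case: (eqVneq (mu n x) 0) => [mu0|mu_neq0]; last by rewrite mulrC divfK.
by rewrite joint_eq0_fst // mul0r mulr0.
Qed.

Local Open Scope classical_set_scope.

Let U := @random_history R S E x0 chain_weight.

(** Times start at 0, so the state at time [n] heads the history of length [n.+1]. *)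
Definition chain_state (n : nat) (t : R) : S := head x0 (U n.+1 t).

Let U_prob := random_history_prob E x0 uniq_E chain_weight erefl
  chain_weight_ge0 chain_weight_sum.

Let U_measurable := measurable_random_history E x0 uniq_E chain_weight erefl
  chain_weight_ge0 chain_weight_sum.

Lemma mem_chain_state (n : nat) (t : R) : chain_state n t \in E n.
Proof.
have := mem_random_history E x0 uniq_E chain_weight erefl chain_weight_sum
  n.+1 t.
rewrite random_historyS -/(chain_state n t).
by case/allpairsP=> -[x h] /= [xE _ [-> _]].
Qed.

Lemma measurable_chain_state (n : nat) (x : S) :
  measurable (chain_state n @^-1` [set x]).
Proof.
have := U_measurable n.+1 [pred h | head x0 h == x].
rewrite (_ : _ @^-1` _ = chain_state n @^-1` [set x]) //.
by apply/seteqP; split=> t /= /eqP.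
Qed.

Lemma chain_state_prob (n : nat) (x : S) : x \in E n ->
  unit_itv_measure R (chain_state n @^-1` [set x]) = (mu n x)%:E.
Proof.
move=> xE; have := U_prob n.+1 [pred h | head x0 h == x].
rewrite (_ : _ @^-1` _ = chain_state n @^-1` [set x]); last first.
  by apply/seteqP; split=> t /= /eqP.
move=> ->; congr _%:E; rewrite -chain_weight_marginal // [histories _ _]/=.
rewrite big_mkcond big_allpairs_dep /= (bigD1_seq x) //=.
rewrite [X in _ + X]big1 ?addr0.
  by rewrite eqxx.
by move=> y /negbTE neq_yx; rewrite big1 // => h _; rewrite neq_yx.
Qed.

Lemma chain_joint_prob (n : nat) (x y : S) : x \in E n -> y \in E n.+1 ->
  unit_itv_measure R
    (chain_state n @^-1` [set x] `&` chain_state n.+1 @^-1` [set y]) =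
  (J n x y)%:E.
Proof.
move=> xE yE.
have := U_prob n.+2 [pred h | (head x0 h == y) && (head x0 (behead h) == x)].
rewrite (_ : _ @^-1` _ =
  chain_state n @^-1` [set x] `&` chain_state n.+1 @^-1` [set y]); last first.
  apply/seteqP; split=> t /=; first by case/andP=> /eqP ? /eqP ?.
  by case=> xt yt; apply/andP; split; apply/eqP.
move=> ->; congr _%:E; rewrite [histories _ _]/=.
rewrite big_mkcond big_allpairs_dep /= (bigD1_seq y) //=.
rewrite [X in _ + X]big1 ?addr0.
  rewrite big_allpairs_dep /= (bigD1_seq x) //= [X in _ + X]big1 ?addr0.
    rewrite !eqxx /=.
    transitivity (\sum_(h <- histories E n) chain_weight (x :: h)
                  * (J n x y / mu n x)).
      rewrite !big_seq; apply: eq_bigr => h; rewrite mem_histories.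
      by case/andP=> /eqP <- _.
    rewrite -mulr_suml chain_weight_marginal //.
    case: (eqVneq (mu n x) 0) => [mu0|mu_neq0]; last by rewrite mulrC divfK.
    by rewrite joint_eq0_fst // mul0r mulr0.
  by move=> z /negbTE neq_zx; rewrite big1 // => h _; rewrite neq_zx andbF.
move=> z /negbTE neq_zy; rewrite big_allpairs_dep big1 // => x' _.
by rewrite big1 // => h _; rewrite neq_zy.
Qed.

(** Prescribing all states up to a time amounts to prescribing one history, so the claim is the
    recursive equation of [chain_weight]. This is the Markov property in product form. *)
Lemma chain_path_prob (n : nat) (s : nat -> S) :
  (forall k, (k <= n.+1)%N -> s k \in E k) ->
  unit_itv_measure R
    [set t | forall k, (k <= n.+1)%N -> chain_state k t = s k] =
  (unit_itv_measure R [set t | forall k, (k <= n)%N -> chain_state k t = s k]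
   * (J n (s n) (s n.+1) / mu n (s n))%:E)%E.
Proof.
(* Reversed because histories list the most recent state first. *)
move=> sE; pose path m := rev (mkseq s m).
have pathS m : path m.+1 = s m :: path m by rewrite /path mkseqS rev_rcons.
have size_path m : size (path m) = m by rewrite size_rev size_mkseq.
have pathE m : [set t | forall k, (k <= m)%N -> chain_state k t = s k] =
    U (size (path m.+1)) @^-1` [set path m.+1].
  rewrite size_path; apply/seteqP; elim: m => [|m [IHm IHm']].
    split=> t /=; first by move=> st; rewrite pathS -st.
    by move=> /(congr1 (head x0)) + k; rewrite leqn0 => + /eqP ->.
  split=> t /= st.
    rewrite pathS -(IHm t) => [|k lekm]; last by apply: st; exact: leqW.
    by rewrite -st.
  move: st; rewrite pathS [U _ _]random_historyS => -[stm st] k.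
  rewrite leq_eqVlt => /predU1P[->|]; first exact: stm.
  by rewrite ltnS; exact: IHm'.
have hist m : (m <= n.+2)%N -> is_history E (path m).
  elim: m => // m IHm lemn; rewrite pathS /= size_path sE //=.
  by apply: IHm; exact: ltnW.
have prob m (lemn : (m <= n.+1)%N) :
    unit_itv_measure R (U (size (path m.+1)) @^-1` [set path m.+1]) =
    (chain_weight (path m.+1))%:E.
  exact: (random_history1_prob E x0 uniq_E chain_weight erefl
    chain_weight_ge0 chain_weight_sum _ (hist m.+1 lemn)).
rewrite !pathE !prob // -EFinM; congr _%:E.
by rewrite (pathS n.+1) (pathS n) chain_weightS size_path.
Qed.

Lemma exists_markov_chain :
  exists (d : measure_display) (T : measurableType d) (P : probability T R)
         (X : nat -> T -> S),
  [/\ forall n t, X n t \in E n,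
      forall n x, measurable (X n @^-1` [set x]),
      forall n x, x \in E n -> P (X n @^-1` [set x]) = (mu n x)%:E,
      forall n x y, x \in E n -> y \in E n.+1 ->
        P (X n @^-1` [set x] `&` X n.+1 @^-1` [set y]) = (J n x y)%:E
    & forall n (s : nat -> S), (forall k, (k <= n.+1)%N -> s k \in E k) ->
        P [set t | forall k, (k <= n.+1)%N -> X k t = s k] =
        (P [set t | forall k, (k <= n)%N -> X k t = s k]
         * (J n (s n) (s n.+1) / mu n (s n))%:E)%E].
Proof.
exists _, _, (unit_itv_measure R : probability _ R), chain_state; split.
- exact: mem_chain_state.
- exact: measurable_chain_state.
- exact: chain_state_prob.
- exact: chain_joint_prob.
- exact: chain_path_prob.
Qed.

End MarkovChain.

(** * Regenerative composition structures *)

(** Grouping the balls by the composition they leave turns the sum over balls into the counting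
    kernel of [sampling_consistent]. *)
Lemma discard_sumE {R : realType} (n : nat) (c : seq nat) (f : seq nat -> R) :
  is_composition n.+1 c ->
  discard_sum f c =
  \sum_(c' <- compositions n)
     #|[set b : 'I_n.+1 | discard_ball c b == c']%SET|%:R * f c'.
Proof.
move=> cc; have /andP[_ /eqP sumc] := cc.
transitivity (\sum_(c' <- compositions n)
    \sum_(b < n.+1) (discard_ball c b == c')%:R * f c'); last first.
  apply: eq_bigr => c' _; rewrite -mulr_suml; congr (_ * _).
  rewrite -sum1_card natr_sum [RHS]big_mkcond /=.
  by apply: eq_bigr => b _; rewrite inE; case: eqP.
rewrite exchange_big /discard_sum sumc big_mkord; apply: eq_bigr => b _ /=.
rewrite (bigD1_seq (discard_ball c b)) ?uniq_compositions //=; last first.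
  by rewrite mem_compositions discard_ball_composition.
rewrite eqxx mul1r big1 ?addr0 // => c' /negbTE neq.
by rewrite eq_sym neq mul0r.
Qed.

(** Positivity of [m] rules out the empty sequence, whose [head] is the default 0. *)
Lemma first_part_cons {d : measure_display} {T : measurableType d}
    (C : nat -> T -> seq nat) (n m : nat) (c : seq nat) : (0 < m)%N ->
  ([set w | behead (C n w) = c] `&` first_part_is C n m =
   C n @^-1` [set m :: c])%classic.
Proof.
move=> m_gt0; apply/seteqP.
split=> w; rewrite /first_part_is /=; last by move=> ->.
by case; case: (C n w) => [|m' c'] /= => [_ m0|-> ->//]; rewrite -m0 in m_gt0.
Qed.

Section RandomCompositionTheory.
Context {d : measure_display} {T : measurableType d} {R : realType}.
Variable P : probability T R.
Local Open Scope classical_set_scope.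

Lemma random_composition_preimage (n : nat) (X : T -> seq nat)
    (Q : pred (seq nat)) : random_composition n X ->
  X @^-1` [set` Q] =
  \bigcup_(c in [set` [seq c <- compositions n | Q c]]) (X @^-1` [set c]).
Proof.
move=> [Xcomp _]; apply/seteqP; split=> w /=.
  move=> Qw; exists (X w) => //=.
  by rewrite mem_filter mem_compositions Xcomp andbT.
by case=> c /=; rewrite mem_filter => /andP[Qc _] ->.
Qed.

Lemma measurable_random_composition (n : nat) (X : T -> seq nat)
    (Q : pred (seq nat)) :
  random_composition n X -> measurable (X @^-1` [set` Q]).
Proof.
move=> Xrand; rewrite (random_composition_preimage n) //.
by apply: fin_bigcup_measurable; [exact: finite_seq|move=> c _; apply Xrand].
Qed.

(** Total probability over finitely many compositions. The event [A] is either the whole space or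
    the value of another composition, which covers laws and joint laws alike. *)
Lemma random_composition_prob (n : nat) (X : T -> seq nat)
    (Q : pred (seq nat)) (A : set T) :
  random_composition n X -> measurable A ->
  fine (P (A `&` X @^-1` [set` Q])) =
    \sum_(c <- compositions n | Q c) fine (P (A `&` X @^-1` [set c])).
Proof.
move=> Xrand mA; have [_ Xmeas] := Xrand.
rewrite (random_composition_preimage n) // setI_bigcupr measure_fin_bigcup.
- rewrite -fsbig_seq ?filter_uniq ?uniq_compositions // big_filter.
  rewrite (eq_bigr (fun c => (fine (P (A `&` X @^-1` [set c])))%:E)).
    by rewrite sumEFin.
  by move=> c _; rewrite fineK // fin_num_measure //; exact: measurableI.
- exact: finite_seq.
- by move=> c c' _ _ [w [[_ /= <-] [_ /= <-]]].
- by move=> c _; exact: measurableI.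
Qed.

Lemma first_part_preimage (C : nat -> T -> seq nat) (n m : nat) :
  first_part_is C n m = C n @^-1` [set` [pred c | head 0%N c == m]].
Proof. by apply/seteqP; split=> w /= /eqP. Qed.

(** * From a regenerative composition structure to the recursion *)

Section Necessity.
Variables (C : nat -> T -> seq nat) (q : nat -> nat -> R).
Hypothesis C_struct : composition_structure P C.
Hypothesis C_regen : regenerative P C.
Hypothesis C_decr : is_decrement_matrix P C q.

Let C_comp (n : nat) : (0 < n)%N -> random_composition n (C n).
Proof. by case: C_struct => Ccomp _ _; exact: Ccomp. Qed.

(** Strong induction on [n], conditioning on the first part: regeneration makes the rest a copy of
    the structure at size [n - m]. *)
Lemma regenerative_law (n : nat) (c : seq nat) : (0 < n)%N ->
  is_composition n c -> fine (P (C n @^-1` [set c])) = comp_law q c.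
Proof.
elim/ltn_ind: n c => n IHn c n_gt0 cc; have [Ccomp Cmeas] := C_comp n n_gt0.
case: c cc => [|m c]; first by case: n n_gt0 {IHn Ccomp Cmeas}.
rewrite is_composition_cons => /and3P[m_gt0 lemn cc].
have sumc : sumn c = (n - m)%N by case/andP: cc => _ /eqP.
have Pfirst := C_decr n m (introT andP (conj m_gt0 lemn)).
rewrite /= sumc subnKC //.
(* Regeneration is silent for [m = n]; there the first part determines the whole composition. *)
case: (ltnP m n) => [ltmn|lenm]; last first.
  have eqmn : m = n by lia.
  move: cc; rewrite eqmn subnn is_composition0 => /eqP ->.
  rewrite (_ : _ @^-1` _ = first_part_is C n m) ?Pfirst ?eqmn ?mulr1 //.
  apply/seteqP; split=> w; rewrite /first_part_is /=; first by move=> ->.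
  have := Ccomp w; case: (C n w) => [+ _|m' c' + /= eqm'].
    by case/andP=> _ /eqP /= n0; rewrite -n0 in n_gt0.
  rewrite eqm' is_composition_cons subnn is_composition0.
  by case/and3P=> _ _ /eqP ->.
rewrite -(IHn (n - m)%N) //; [|lia|lia].
rewrite -first_part_cons //.
(* When the conditioning event is null, both sides are 0 by monotonicity. *)
have [q0|q_neq0] := eqVneq (q n m) 0.
  rewrite q0 mul0r first_part_cons //.
  suff -> : P (C n @^-1` [set m :: c]) = 0%E by [].
  apply/eqP; rewrite eq_le measure_ge0 andbT.
  have mfirst : measurable (first_part_is C n m).
    rewrite first_part_preimage.
    exact: measurable_random_composition (C_comp n n_gt0).
  rewrite (_ : 0%E = P (first_part_is C n m)); last by rewrite Pfirst q0.
  apply: le_measure; rewrite ?inE // => w /=.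
  by rewrite /first_part_is /= => ->.
have Pfirst_neq0 : P (first_part_is C n m) != 0%E by rewrite Pfirst.
have := C_regen n m (introT andP (conj m_gt0 ltmn)) Pfirst_neq0 c.
by rewrite /cond_prob Pfirst /= => <-; rewrite mulrC divfK.
Qed.

Lemma regenerative_mass1 (n : nat) : comp_expect q n (fun=> 1) = 1.
Proof.
case: n => [|n]; first by rewrite comp_expect0.
have := random_composition_prob n.+1 (C n.+1) xpredT setT
  (C_comp n.+1 isT) measurableT.
rewrite setTI (_ : _ @^-1` _ = setT); last by apply/seteqP; split.
rewrite probability_setT /= => mass1; rewrite [RHS]mass1 /comp_expect !big_seq.
apply: eq_bigr => c; rewrite mem_compositions => cc.
by rewrite setTI regenerative_law // mulr1.
Qed.

(** Both sides are [n.+1] times the mean of [f] at [C n]: conditioning on [C n.+1] and sampling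
    consistency give the left side, summing out [C n.+1] the right side. *)
Lemma regenerative_consistent (n : nat) (f : seq nat -> R) : (0 < n)%N ->
  comp_expect q n.+1 (discard_sum f) = n.+1%:R * comp_expect q n f.
Proof.
move=> n_gt0; have [_ _ Csamp] := C_struct.
have [_ Cmeas] := C_comp n n_gt0; have [_ CmeasS] := C_comp n.+1 isT.
rewrite /comp_expect mulr_sumr.
transitivity (\sum_(c <- compositions n.+1) \sum_(c' <- compositions n)
    n.+1%:R * f c' * fine (P (C n @^-1` [set c'] `&` C n.+1 @^-1` [set c]))).
  rewrite !big_seq; apply: eq_bigr => c; rewrite mem_compositions => cc.
  rewrite (discard_sumE n) // mulr_sumr; apply: eq_bigr => c' _.
  rewrite -(regenerative_law n.+1) //.
  have [Pc0|Pc_neq0] := eqVneq (P (C n.+1 @^-1` [set c])) 0%E.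
    rewrite Pc0 mul0r.
    suff -> : P (C n @^-1` [set c'] `&` C n.+1 @^-1` [set c]) = 0%E.
      by rewrite mulr0.
    apply/eqP; rewrite eq_le measure_ge0 andbT -Pc0.
    by apply: le_measure; rewrite ?inE //; exact: measurableI.
  have := Csamp n c c' n_gt0 Pc_neq0.
  have finePc : fine (P (C n.+1 @^-1` [set c])) != 0.
    by rewrite fine_eq0 // fin_num_measure.
  rewrite /cond_prob => /(canRL (mulfVK finePc)) ->.
  by field.
rewrite exchange_big !big_seq; apply: eq_bigr => c' /=.
rewrite mem_compositions => cc'.
have := random_composition_prob n.+1 (C n.+1) xpredT (C n @^-1` [set c'])
  (C_comp n.+1 isT) (Cmeas c').
rewrite (_ : _ @^-1` [set` _] = setT); last by apply/seteqP; split.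
by rewrite setIT regenerative_law // -mulr_sumr => <-; ring.
Qed.

Lemma regenerative_decrement_recursion :
  q 1%N 1%N = 1 /\ decrement_recursion q.
Proof.
split.
  have := regenerative_mass1 1.
  by rewrite comp_expectS big_nat1 comp_expect0 mulr1.
apply: decrement_recursion_of_mass1; first exact: regenerative_mass1.
by move=> n m m_bnd; apply: regenerative_consistent; lia.
Qed.

End Necessity.
End RandomCompositionTheory.

(** * From the recursion to a regenerative composition structure *)

Section Sufficiency.
Context {R : realType}.
Variable q : nat -> nat -> R.
Hypothesis q_ge0 : forall n m : nat, (1 <= m <= n)%N -> 0 <= q n m.
Hypothesis q11 : q 1%N 1%N = 1.
Hypothesis q_rec : decrement_recursion q.
Local Open Scope classical_set_scope.

(** Joint law of the pair of sizes [n] and [n.+1], specified downwards by discarding from [c]. The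
    chain runs upwards, its transitions being the Bayes reversal of discarding. *)
Definition discard_joint (n : nat) (c' c : seq nat) : R :=
  comp_law q c *
  (#|[set b : 'I_n.+1 | discard_ball c b == c']%SET|%:R / n.+1%:R).

Let J_ge0 (n : nat) (c' c : seq nat) :
  c' \in compositions n -> c \in compositions n.+1 -> 0 <= discard_joint n c' c.
Proof.
move=> _; rewrite mem_compositions => cc.
by rewrite mulr_ge0 ?(comp_law_ge0 _ _ _ q_ge0 cc) // divr_ge0 ?ler0n.
Qed.

Let mu0_ge0 (c : seq nat) : c \in compositions 0 -> 0 <= comp_law q c.
Proof. by rewrite mem_compositions => /(comp_law_ge0 _ _ _ q_ge0). Qed.

Let mu0_sum : \sum_(c <- compositions 0) comp_law q c = 1.
Proof. by rewrite big_seq1. Qed.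

(** The recursion enters here, through [comp_expect_discard] applied to the indicator of [c']. *)
Let J_fst (n : nat) (c' : seq nat) : c' \in compositions n ->
  \sum_(c <- compositions n.+1) discard_joint n c' c = comp_law q c'.
Proof.
move=> c'E; have n1_neq0 : n.+1%:R != 0 :> R by rewrite pnatr_eq0.
apply: (mulfI n1_neq0).
have single (F : seq nat -> R) :
    \sum_(c <- compositions n) F c * (c == c')%:R = F c'.
  rewrite (bigD1_seq c') ?uniq_compositions //= eqxx mulr1.
  by rewrite big1 ?addr0 // => c /negbTE ->; rewrite mulr0.
have := comp_expect_discard q n (fun c => (c == c')%:R) q11 q_rec.
rewrite [in RHS]/comp_expect single => <-; rewrite mulr_sumr /comp_expect.
rewrite !big_seq; apply: eq_bigr => c; rewrite mem_compositions => cc.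
by rewrite (discard_sumE n) // single /discard_joint; field.
Qed.

Let J_snd (n : nat) (c : seq nat) : c \in compositions n.+1 ->
  \sum_(c' <- compositions n) discard_joint n c' c = comp_law q c.
Proof.
rewrite mem_compositions => cc; rewrite -mulr_sumr -mulr_suml.
have := discard_sumE (R := R) n c (fun=> 1) cc.
rewrite discard_sum_const mulr1; have /andP[_ /eqP ->] := cc.
rewrite (eq_bigr _ (fun c' _ => mulr1 _)) => <-.
by rewrite divff ?mulr1 // pnatr_eq0.
Qed.

Section ChainIsRegenerative.
Context {d : measure_display} {T : measurableType d}.
Variables (P : probability T R) (C : nat -> T -> seq nat).
Hypothesis C_mem : forall n t, C n t \in compositions n.
Hypothesis C_meas : forall n c, measurable (C n @^-1` [set c]).
Hypothesis C_prob : forall n c, c \in compositions n ->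
  P (C n @^-1` [set c]) = (comp_law q c)%:E.
Hypothesis C_joint : forall n c' c,
  c' \in compositions n -> c \in compositions n.+1 ->
  P (C n @^-1` [set c'] `&` C n.+1 @^-1` [set c]) = (discard_joint n c' c)%:E.
Hypothesis C_path : forall n (s : nat -> seq nat),
  (forall k, (k <= n.+1)%N -> s k \in compositions k) ->
  P [set t | forall k, (k <= n.+1)%N -> C k t = s k] =
  (P [set t | forall k, (k <= n)%N -> C k t = s k]
   * (discard_joint n (s n) (s n.+1) / comp_law q (s n))%:E)%E.

Lemma chain_random (n : nat) : random_composition n (C n).
Proof.
by split=> [t|c]; [rewrite -mem_compositions; exact: C_mem|exact: C_meas].
Qed.

Let C_empty (n : nat) (c : seq nat) :
  c \notin compositions n -> C n @^-1` [set c] = set0.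
Proof.
by move=> cE; apply/seteqP; split=> // t /= Ct; rewrite -Ct C_mem in cE.
Qed.

(** By [C_path] the probability of the past cancels, leaving the ratio of joint law to marginal,
    which is also the one-step conditional probability. *)
Lemma chain_markovian : markovian P C.
Proof.
move=> n c n_gt0 past past_neq0.
have [cE|cE] := boolP (c n.+1 \in compositions n.+1); last first.
  by rewrite /cond_prob C_empty // !set0I measure0 /= !mul0r.
have cE' k : (1 <= k <= n)%N -> c k \in compositions k.
  move=> k_bnd; apply: contraNT past_neq0 => cE'.
  rewrite (_ : past = set0) ?measure0 //; apply/seteqP; split=> // t /=.
  by move=> /(_ k k_bnd) ct; rewrite -ct C_mem in cE'.
(* The Markov property starts at time 1 and the chain at time 0, where its only state is the empty
   composition. *)
pose s k := if k == 0%N then [::] else c k.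
have C0 t : C 0 t = [::] by apply/eqP; have := C_mem 0 t; rewrite inE.
have pathE m : [set t | forall k, (1 <= k <= m)%N -> C k t = c k] =
    [set t | forall k, (k <= m)%N -> C k t = s k].
  apply/seteqP; split=> t /= Ct k.
    by case: k => [|k] lekm; [exact: C0|exact: Ct].
  by case: k => // k lekm; exact: Ct.
have pastS : C n.+1 @^-1` [set c n.+1] `&` past =
    [set t | forall k, (1 <= k <= n.+1)%N -> C k t = c k].
  apply/seteqP; split=> t /=.
    move=> [Ct Cpast] k /andP[k_gt0]; rewrite leq_eqVlt => /predU1P[-> //|].
    by rewrite ltnS => lekn; apply: Cpast; rewrite k_gt0.
  by move=> Ct; split=> [|k k_bnd]; apply: Ct; lia.
have sE k : (k <= n.+1)%N -> s k \in compositions k.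
  case: k => // k; rewrite leq_eqVlt => /predU1P[[->] //|ltkn].
  exact: cE'.
have s_n : s n = c n by case: n n_gt0 {past past_neq0 cE cE' pastS sE}.
have fin_past : P past \is a fin_num.
  apply: fin_num_measure.
  rewrite (_ : past =
    \bigcap_(k in [set k | (1 <= k <= n)%N]) (C k @^-1` [set c k])) //.
  apply: bigcap_measurable => [|k _]; last exact: C_meas.
  by exists 1%N; rewrite /= n_gt0.
rewrite /cond_prob pastS pathE C_path // -pathE -/past s_n /=.
rewrite fineM // mulrAC divff ?mul1r; last by rewrite fine_eq0.
have cnE : c n \in compositions n by apply: cE'; rewrite n_gt0 leqnn.
by rewrite setIC C_joint // C_prob.
Qed.

(** Dividing [discard_joint] by its factor [comp_law q c] leaves the ball count. If [c'] is not a
    composition of [n], no ball leads to it and both sides are 0. *)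
Lemma chain_sampling_consistent : sampling_consistent P C.
Proof.
move=> n c c' n_gt0 Pc_neq0.
have cE : c \in compositions n.+1.
  by apply: contraNT Pc_neq0 => cE; rewrite C_empty // measure0.
have law_neq0 : comp_law q c != 0.
  by apply: contraNneq Pc_neq0 => law0; rewrite C_prob // law0.
rewrite /cond_prob C_prob //.
have [c'E|c'E] := boolP (c' \in compositions n).
  by rewrite C_joint //= /discard_joint mulrAC divff ?mul1r.
rewrite C_empty // set0I measure0 mul0r.
rewrite eq_card0 ?mul0r // => b; rewrite !inE; apply: contraNF c'E => /eqP <-.
by rewrite mem_compositions discard_ball_composition // -mem_compositions.
Qed.

Lemma chain_decrement_matrix : is_decrement_matrix P C q.
Proof.
move=> n m m_bnd; rewrite first_part_preimage -[LHS]fineK; last first.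
  rewrite fin_num_measure //.
  exact: measurable_random_composition (chain_random n).
have := random_composition_prob P n (C n) [pred c | head 0%N c == m] setT
  (chain_random n) measurableT.
rewrite setTI => ->; congr _%:E.
rewrite -(comp_expect_head q n m) //; last first.
  by move=> k; exact: comp_expect1.
rewrite big_mkcond /comp_expect !big_seq; apply: eq_bigr => c cE /=.
by rewrite setTI C_prob //=; case: eqP => _; rewrite ?mulr1 ?mulr0.
Qed.

(** The product law of [m :: c] is [q n m] times that of [c], so conditioning on the first part
    removes exactly this factor. *)
Lemma chain_regenerative : regenerative P C.
Proof.
move=> n m m_bnd Pfirst_neq0 c.
have m_bnd' : (1 <= m <= n)%N by lia.
have q_neq0 : q n m != 0.
  by apply: contraNneq Pfirst_neq0 => q0; rewrite chain_decrement_matrix // q0.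
rewrite /cond_prob chain_decrement_matrix //=.
rewrite first_part_cons; last by case/andP: m_bnd.
have consE : (m :: c \in compositions n) = (c \in compositions (n - m)).
  by rewrite !mem_compositions is_composition_cons; lia.
have [cE|cE] := boolP (c \in compositions (n - m)); last first.
  by rewrite !C_empty ?consE // measure0 mul0r.
rewrite !C_prob ?consE //=.
move: cE; rewrite mem_compositions => /andP[_ /eqP ->].
by rewrite subnKC; [rewrite mulrAC divff ?mul1r|lia].
Qed.

End ChainIsRegenerative.

Lemma exists_regenerative_structure :
  exists (d : measure_display) (T : measurableType d) (P : probability T R)
         (C : nat -> T -> seq nat),
    [/\ composition_structure P C, regenerative P C
      & is_decrement_matrix P C q].
Proof.
have [d [T [P [C [C_mem C_meas C_prob C_joint C_path]]]]] :=
  (* The marginal is one function at all times, since [comp_law] recovers the size from its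
     argument. *)
  exists_markov_chain compositions [::] (fun=> comp_law q) discard_joint
    uniq_compositions J_ge0 mu0_ge0 mu0_sum J_fst J_snd.
exists d, T, P, C; split; [split| |].
- by move=> n _; exact: chain_random.
- exact: chain_markovian.
- exact: chain_sampling_consistent.
- exact: chain_regenerative.
- exact: chain_decrement_matrix.
Qed.

End Sufficiency.

Theorem proposition3p3 (R : realType) (q : nat -> nat -> R)
    (q_ge0 : forall n m : nat, (1 <= m <= n)%N -> 0 <= q n m) :
  (exists (d : measure_display) (T : measurableType d) (P : probability T R)
          (C : nat -> T -> seq nat),
     [/\ composition_structure P C, regenerative P C
       & is_decrement_matrix P C q])
  <->
  (q 1%N 1%N = 1 /\
   forall n m : nat, (1 <= m <= n)%N ->
     q n m = m.+1%:R / n.+1%:R * q n.+1 m.+1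
             + (n.+1 - m)%N%:R / n.+1%:R * q n.+1 m
             + n.+1%:R^-1 * q n.+1 1%N * q n m).
Proof.
split=> [[d [T [P [C [C_struct C_regen C_decr]]]]]|[q11 q_rec]].
  exact: regenerative_decrement_recursion C_struct C_regen C_decr.
exact: exists_regenerative_structure.
Qed.
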